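(* Let $\mu>0$ and let $G:\mathbb{H}\to\mathbb{R}$ be $\mu$-strongly convex and locally Lipschitz smooth with respect to the $\mathcal{L}$-norm. Put $\tilde G(v):=G(v)-\frac{\mu}{4}\|v\|_{\mathcal{L}}^2$. Then, for any $B\subset\mathbb{H}$ bounded and convex, there is $\hat L_B>0$ such that $$\frac{1}{\hat L_B}\|\delta\tilde G(v)-\delta\tilde G(u)\|_{\mathcal{L}^{-1}}^2\le\langle\delta\tilde G(v)-\delta\tilde G(u),v-u\rangle\qquad\forall u,v\in B,$$ and, for any such $\hat L_B$, setting $$C_{B1}:=\frac{\mu^2+2\mu\hat L_B}{4\hat L_B+4\mu}>0,\qquad C_{B2}:=\frac{1}{\mu+\hat L_B}>0,$$ one has, for all $u,v\in B$, $$\langle\delta G(v)-\delta G(u),v-u\rangle\ge C_{B1}\|v-u\|_{\mathcal{L}}^2+C_{B2}\|\delta G(v)-\delta G(u)\|_{\mathcal{L}^{-1}}^2.$$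
   Context: $\mathbb{H}$ is a real separable Hilbert space with dual $\mathbb{H}^*$ and duality pairing $\langle\phi,v\rangle$ ($\phi\in\mathbb{H}^*$, $v\in\mathbb{H}$). All functionals $\mathbb{H}\to\mathbb{R}$ are assumed continuously Fréchet differentiable; $\delta G:\mathbb{H}\to\mathbb{H}^*$ denotes the Fréchet derivative of $G$. A preconditioner is a bounded linear map $\mathcal{L}:\mathbb{H}\to\mathbb{H}^*$ such that the bilinear form $(u,v)_{\mathcal{L}}:=\langle\mathcal{L}u,v\rangle$ is symmetric and there are $C_1,C_2>0$ with $(u,v)_{\mathcal{L}}\le C_2\|u\|_{\mathbb{H}}\|v\|_{\mathbb{H}}$ and $C_1\|u\|_{\mathbb{H}}^2\le(u,u)_{\mathcal{L}}$ for all $u,v\in\mathbb{H}$. A preconditioner $\mathcal{L}$ is fixed. Write $\|v\|_{\mathcal{L}}:=\sqrt{(v,v)_{\mathcal{L}}}$ for $v\in\mathbb{H}$ and $\|\phi\|_{\mathcal{L}^{-1}}:=\sqrt{\langle\phi,\mathcal{L}^{-1}\phi\rangle}$ for $\phi\in\mathbb{H}^*$. $G$ is $\mu$-strongly convex with respect to the $\mathcal{L}$-norm if $\langle\delta G(u)-\delta G(v),u-v\rangle\ge\mu\|u-v\|_{\mathcal{L}}^2$ for all $u,v\in\mathbb{H}$. $G$ is locally Lipschitz smooth with respect to the $\mathcal{L}$-norm if for every bounded convex $B\subset\mathbb{H}$ there is $L_B>0$ such that $\langle\delta G(u)-\delta G(v),u-v\rangle\le L_B\|u-v\|_{\mathcal{L}}^2$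 for all $u,v\in B$; equivalently, $G(v)\le G(u)+\langle\delta G(u),v-u\rangle+\frac{L_B}{2}\|v-u\|_{\mathcal{L}}^2$ for all $u,v\in B$. *)

(* Defs.v *)
From HB Require Import structures.
From mathcomp Require Import all_boot all_order all_algebra.
From mathcomp Require Import all_classical all_reals all_analysis.
Set Implicit Arguments.
Unset Strict Implicit.
Unset Printing Implicit Defensive.
Import Order.TTheory GRing.Theory Num.Theory.
Import numFieldNormedType.Exports.
Local Open Scope classical_set_scope.
Local Open Scope ring_scope.

HB.mixin Record CompleteNormedModule_isHilbert (R : realType) H
    of CompleteNormedModule R H := {
  (* idfun instead of conjugation: real, symmetric, positive definite *)
  inner : {dot H for @idfun R};
  norm_inner : forall v : H, `|v| = Num.sqrt (inner v v)
}.

#[short(type="hilbertType")]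
HB.structure Definition Hilbert (R : realType) :=
  {H of CompleteNormedModule R H & CompleteNormedModule_isHilbert R H}.

Definition separable (T : topologicalType) :=
  exists2 D : set T, countable D & dense D.

(* dual V, the space of continuous linear functionals on V, is made below into a
   normed module for the operator norm; the duality pairing is application. *)
Definition in_dual (R : realType) (V : normedModType R) : {pred V -> R} :=
  fun f => `[< linear f /\ continuous f >].

Record dual (R : realType) (V : normedModType R) := Dual {
  dual_fun :> V -> R ;
  _ : dual_fun \in @in_dual R V }.

Section dual_lmod.
Context {R : realType} {V : normedModType R}.
Implicit Types phi psi : dual V.

HB.instance Definition _ := [isSub for @dual_fun R V].
HB.instance Definition _ := [Choice of dual V by <:].

Lemma in_dual_submod_closed : submod_closed (@in_dual R V).
Proof.
split=> [|a f g /asboolP[lf cf] /asboolP[lg cg]]; apply/asboolP; split.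
- by move=> a u v; rewrite /= scaler0 addr0.
- exact: cst_continuous.
- move=> b u v; rewrite /= !fctE lf lg !scalerDr !scalerA [a * b]mulrC.
  by rewrite addrACA.
- by move=> x; apply: cvgD; [apply: cvgZr; exact: cf|exact: cg].
Qed.

HB.instance Definition _ :=
  GRing.isSubmodClosed.Build R (V -> R) (@in_dual R V) in_dual_submod_closed.
HB.instance Definition _ := [SubChoice_isSubLmodule of dual V by <:].

Lemma dual_linear phi : linear phi.
Proof. by case: phi => f /= /asboolP[]. Qed.

Lemma dual_continuous phi : continuous phi.
Proof. by case: phi => f /= /asboolP[]. Qed.

HB.instance Definition _ phi :=
  GRing.isLinear.Build R V R _ phi (dual_linear phi).

Definition dual_norm phi : R := sup [set `|phi v| | v in [set v | `|v| <= 1]].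

Lemma dual_norm_has_sup phi :
  has_sup [set `|phi v| | v in [set v | `|v| <= 1]].
Proof.
split; first by exists `|phi 0|, 0 => //=; rewrite normr0 ler01.
have : bounded_near phi (nbhs (0 : V)).
  by apply/linear_bounded_continuous; exact: dual_continuous.
move=> /bounded_funP /(_ 1)[M HM].
by exists M => _ [v v1 <-]; exact: HM.
Qed.

Lemma dual_norm_ub phi v : `|phi v| <= dual_norm phi * `|v|.
Proof.
have [->|v0] := eqVneq v 0; first by rewrite linear0 !normr0 mulr0.
have nv : 0 < `|v| by rewrite normr_gt0.
rewrite -ler_pdivrMr// [X in X <= _](_ : _ = `|phi (`|v|^-1 *: v)|); last first.
  by rewrite linearZ/= normrM normfV normr_id mulrC.
apply: (sup_upper_bound (dual_norm_has_sup phi)).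
exists (`|v|^-1 *: v) => //=.
by rewrite normrZ normfV normr_id mulVf ?gt_eqF.
Qed.

Lemma dual_norm_le phi (M : R) :
  (forall v, `|v| <= 1 -> `|phi v| <= M) -> dual_norm phi <= M.
Proof.
move=> phiM; apply: ge_sup; first by have [] := dual_norm_has_sup phi.
by move=> _ [v v1 <-]; exact: phiM.
Qed.

Lemma dual_norm_ge0 phi : 0 <= dual_norm phi.
Proof.
apply: (le_trans (normr_ge0 (phi 0))).
apply: (sup_upper_bound (dual_norm_has_sup phi)).
by exists 0 => //=; rewrite normr0 ler01.
Qed.

Lemma dual_normD phi psi : dual_norm (phi + psi) <= dual_norm phi + dual_norm psi.
Proof.
apply: dual_norm_le => v v1; apply: le_trans (ler_normD _ _) _.
by apply: lerD; apply: le_trans (dual_norm_ub _ _) _;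
  rewrite ler_piMr ?dual_norm_ge0.
Qed.

Lemma dual_normZ (a : R) phi : dual_norm (a *: phi) = `|a| * dual_norm phi.
Proof.
have nZ b psi : dual_norm (b *: psi) <= `|b| * dual_norm psi.
  apply: dual_norm_le => v v1.
  rewrite [X in `|X|](_ : _ = b * psi v)// normrM ler_wpM2l//.
  by apply: le_trans (dual_norm_ub _ _) _; rewrite ler_piMr ?dual_norm_ge0.
apply/eqP; rewrite eq_le nZ/=.
have [->|a0] := eqVneq a 0; first by rewrite normr0 mul0r dual_norm_ge0.
rewrite -ler_pdivlMl ?normr_gt0//.
by rewrite -[X in dual_norm X <= _](scalerK a0) -normfV nZ.
Qed.

Lemma dual_norm0_eq0 phi : dual_norm phi = 0 -> phi = 0.
Proof.
move=> phi0; apply: val_inj; apply/funext => v /=.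
by apply/eqP; rewrite -normr_le0 (le_trans (dual_norm_ub _ _))// phi0 mul0r.
Qed.

HB.instance Definition _ := Lmodule_isNormed.Build R (dual V)
  dual_normD dual_normZ dual_norm0_eq0.

Lemma dual_normE phi : `|phi| = sup [set `|phi v| | v in [set v | `|v| <= 1]].
Proof. by []. Qed.

End dual_lmod.

Section preconditioner.
Context {R : realType} {H : hilbertType R}.
Implicit Types (L : {linear H -> dual H}) (G : H -> R) (mu : R).

(* The junk value 0 is only taken where 'd G u is not continuous, hence not at
   points of differentiability: see frechetE. *)
Definition frechet G (u : H) : dual H := insubd 0 ('d G u : H -> R).

Lemma frechetE G u : differentiable G u -> frechet G u = 'd G u :> (H -> R).
Proof.
move=> dG; rewrite /frechet insubdK//; apply/asboolP; split.
- exact: linearP.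
- exact: diff_continuous.
Qed.

Definition continuously_differentiable G :=
  (forall u, differentiable G u) /\ continuous (frechet G).

Definition ipL L (u v : H) : R := L u v.

Definition preconditioner L :=
  [/\ exists M : R, forall u, `|L u| <= M * `|u|,
      forall u v, ipL L u v = ipL L v u,
      exists2 C2, 0 < C2 & forall u v, ipL L u v <= C2 * `|u| * `|v| &
      exists2 C1, 0 < C1 & forall u, C1 * `|u| ^+ 2 <= ipL L u u].

Definition normL L (v : H) : R := Num.sqrt (ipL L v v).

(* For a preconditioner L this is the genuine two-sided inverse, L being
   bijective by the Lax-Milgram theorem. *)
Definition invL L : dual H -> H := 'pinv_(fun=> 0) setT L.

Definition normLV L (phi : dual H) : R := Num.sqrt (phi (invL L phi)).

Definition strongly_convex L mu G := forall u v,
  mu * normL L (u - v) ^+ 2 <= (frechet G u - frechet G v) (u - v).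

Definition locally_Lipschitz_smooth L G :=
  forall B : set H, bounded_set B -> convex_set B ->
  exists2 LB, 0 < LB & forall u v, B u -> B v ->
    (frechet G u - frechet G v) (u - v) <= LB * normL L (u - v) ^+ 2.

End preconditioner.

(* Main.v *)
Require Import Defs.
From HB Require Import structures.
From mathcomp Require Import all_boot all_order all_algebra.
From mathcomp Require Import all_classical all_reals all_analysis.
From mathcomp Require Import ring lra.
Set Implicit Arguments.
Unset Strict Implicit.
Unset Printing Implicit Defensive.
Import Order.TTheory GRing.Theory Num.Theory.
Import numFieldNormedType.Exports.
Local Open Scope classical_set_scope.
Local Open Scope ring_scope.

(** Subtracting [mu / 4 * normL L v ^+ 2] from [G] removes only half of its
    strong convexity: [Gt] is still monotone, and still smooth on bounded convex
    sets. So the question is the cocoercivity on [B] of the gradient of a convex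
    function that is smooth only locally.

    As for globally smooth functions, one compares a convex [F] with its tangent
    at [u] after a gradient step from [v], and symmetrises in [u] and [v]
    ([gradient_step_gain], [monotone_cocoercive]). The difficulty is that the
    step may leave [B], where the smoothness constant says nothing. One
    therefore takes the constant [K] of a larger ball, which contains every
    point at [L]-distance at most [normL L (v - u)] from [v], for all [u] and
    [v] in [B]. A step of precisely that length already shows that the gradient
    increment has dual norm at most [K * normL L (v - u)], so the optimal step,
    of size [K^-1], stays in this ball as well.

    The dual norm is the [L]-norm of a preimage because [L] is onto
    ([lax_milgram]). The second claim is algebra: the gradient increment of [Gt]
    is that of [G] minus [(mu / 2) *: L (v - u)]; expanding its squared dual
    norm ([normLV_subL_sqr]) in the cocoercivity inequality and solving for the
    pairing of the gradient increment of [G] with [v - u] yields [CB1] and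
    [CB2]. *)

Section energy_form.
Context {R : realType} {H : hilbertType R}.
Implicit Types (L : {linear H -> dual H}) (u v w : H) (phi psi : dual H).

(** * The energy form of a preconditioner *)

Lemma dualBE phi psi v : (phi - psi) v = phi v - psi v. Proof. by []. Qed.

Lemma ipLDl L u v w : ipL L (u + v) w = ipL L u w + ipL L v w.
Proof. by rewrite /ipL linearD. Qed.
Lemma ipLDr L u v w : ipL L w (u + v) = ipL L w u + ipL L w v.
Proof. by rewrite /ipL linearD. Qed.
Lemma ipLZl L (a : R) u w : ipL L (a *: u) w = a * ipL L u w.
Proof. by rewrite /ipL linearZ. Qed.
Lemma ipLZr L (a : R) u w : ipL L w (a *: u) = a * ipL L w u.
Proof. by rewrite /ipL linearZ. Qed.
Lemma ipLNl L u w : ipL L (- u) w = - ipL L u w.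
Proof. by rewrite /ipL linearN. Qed.
Lemma ipLNr L u w : ipL L w (- u) = - ipL L w u.
Proof. by rewrite /ipL linearN. Qed.

Definition ipLE := (ipLDl, ipLDr, ipLZl, ipLZr, ipLNl, ipLNr).

Lemma ipL_ge0 L u : preconditioner L -> 0 <= ipL L u u.
Proof.
move=> [_ _ _ [C1 C10 /(_ u)]]; apply: le_trans.
by rewrite mulr_ge0 ?exprn_ge0// ltW.
Qed.

Lemma normL_sqr L u : preconditioner L -> normL L u ^+ 2 = ipL L u u.
Proof. by move=> pL; rewrite sqr_sqrtr// ipL_ge0. Qed.

Lemma normL_distC L u v : normL L (u - v) = normL L (v - u).
Proof. by rewrite -[u - v]opprB /normL ipLNl ipLNr opprK. Qed.

(** The remainder of the first-order expansion is exactly [ipL L h h], which is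
    at most [C2 * `|h| ^+ 2]; the symmetry of the form turns its two cross terms
    into the single functional [2 *: L u]. *)
Lemma is_diff_ipL L u : preconditioner L ->
  is_diff u (fun v => ipL L v v) (2 *: L u : dual H).
Proof.
move=> pL; have [_ sym [C2 C20 LC2] _] := pL.
pose df : {linear H -> R} := (2 *: L u : dual H).
have cdf : continuous df by exact: dual_continuous.
have E : (fun v => ipL L v v) \o shift u = cst (ipL L u u) + df +o_ 0 id.
  apply/eqaddoP => _/posnumP[e]; near=> h.
  rewrite -[X in `|X|]/(ipL L (h + u) (h + u) - (ipL L u u + 2 * ipL L u h)).
  rewrite [X in `|X|](_ : _ = ipL L h h); last first.
    by rewrite !ipLE (sym h u); ring.
  rewrite ger0_norm ?ipL_ge0//; apply: le_trans (LC2 _ _) _.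
  rewrite ler_wpM2r// -ler_pdivlMl//.
  near: h; apply/nbhs_le_nbhs_norm.
  exists (C2^-1 * e%:num) => /=; first by rewrite mulr_gt0 ?invr_gt0.
  by move=> h; rewrite /= sub0r normrN => /ltW.
have D := diff_unique cdf E.
apply: DiffDef; last exact: D.
by apply/diff_locallyP; rewrite D.
Unshelve. all: by end_near. Qed.

(** The witness [t] is the minimiser of [t * a + t ^+ 2 * (b + 1 / 2)], whose
    leading coefficient stays positive when [b = 0]. *)
Lemma quadratic_ge0_lin0 (a b : R) : 0 <= b ->
  (forall t, 0 <= t * a + t ^+ 2 * b) -> a = 0.
Proof.
move=> b0 /(_ (- a / (2 * b + 1))) h.
have c0 : 0 < 2 * b + 1 by lra.
apply/eqP; rewrite -[_ == _](sqrf_eq0 a) eq_le sqr_ge0 andbT.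
have : 0 <= (- (b + 1) * a ^+ 2) / (2 * b + 1) ^+ 2.
  rewrite [leRHS](_ : _ = - a / (2 * b + 1) * a +
    (- a / (2 * b + 1)) ^+ 2 * b)//.
  by field; lra.
rewrite pmulr_lge0 ?invr_gt0 ?exprn_gt0//; nra.
Qed.

(** * Surjectivity of the preconditioner and the dual norm *)

(** As the form is symmetric, a solution is a minimiser of the energy
    [J v = ipL L v v - 2 * phi v]. The energy is bounded below by coercivity; by
    the parallelogram identity the distance between two almost minimisers is
    controlled by their excess energies, so a minimising sequence is Cauchy. At
    its limit [w] the first variation [2 * (ipL L w h - phi h)] vanishes. *)
Lemma lax_milgram L phi : preconditioner L -> exists w, L w = phi.
Proof.
move=> pL; have [_ sym _ [C1 C10 LC1]] := pL.
pose J v := ipL L v v - 2 * phi v.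
pose A := range J.
have A0 : A !=set0 by exists (J 0), 0.
have infA : has_inf A.
  split=> //; exists (- (`|phi| ^+ 2 / C1)) => _ [v _ <-].
  have h1 := LC1 v; have h2 := dual_norm_ub phi v.
  have h3 : phi v <= `|phi| * `|v| := le_trans (ler_norm _) h2.
  (* completing the square in `|v| *)
  have h4 : 0 <= (C1 * `|v| - `|phi|) ^+ 2 / C1.
    by rewrite mulr_ge0 ?sqr_ge0 ?invr_ge0 ?ltW.
  have h5 : (C1 * `|v| - `|phi|) ^+ 2 / C1 =
    C1 * `|v| ^+ 2 - 2 * (`|phi| * `|v|) + `|phi| ^+ 2 / C1 by field; lra.
  rewrite /J; lra.
have Jm v : inf A <= J v by apply: (ge_inf infA.2); exists v.
have /choice[y Jy] : forall n : nat, exists v, J v < inf A + n.+1%:R^-1.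
  move=> n; have [|_ [v _ <-] ?] := @inf_adherent _ A n.+1%:R^-1 _ infA.
    by rewrite invr_gt0.
  by exists v.
(* parallelogram identity, with J at the midpoint at least inf A *)
have par u v : C1 * `|u - v| ^+ 2 <= 2 * (J u - inf A) + 2 * (J v - inf A).
  apply: le_trans (LC1 _) _; have := Jm (2^-1 *: (u + v)).
  have phiE : phi (2^-1 *: (u + v)) = 2^-1 * (phi u + phi v).
    by rewrite linearZ linearD.
  rewrite /J phiE !ipLE (sym v u); lra.
have cy : cvgn y.
  apply/cauchy_cvgP/cauchy_exP => _/posnumP[e].
  pose d := C1 * e%:num ^+ 2 / 4.
  have d0 : 0 < d by rewrite divr_gt0// mulr_gt0// exprn_gt0.
  have [N _ HN] := near_infty_natSinv_lt (PosNum d0).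
  exists (y N); exists N => // n Nn.
  rewrite /= -ball_normE /=.
  rewrite -(@ltr_pXn2r _ 2) ?nnegrE// -(ltr_pM2l C10).
  apply: le_lt_trans (par _ _) _.
  have Jlt k : (N <= k)%N -> J (y k) - inf A < d.
    by move=> Nk; rewrite ltrBlDl (lt_trans (Jy k))// ltrD2l; exact: HN.
  have := Jlt _ (leqnn N); have := Jlt _ Nn; rewrite /d; lra.
pose w := limn y.
have Jw : J w <= inf A.
  have cJ : {for w, continuous J}.
    apply: (@continuousB _ _ _ _ (fun v => 2 * phi v)).
      apply: differentiable_continuous.
      exact: (@ex_diff _ _ _ _ _ _ _ (is_diff_ipL w pL)).
    by apply: continuousM; [exact: cst_continuous|exact: dual_continuous].
  have Jyw : J (y n) @[n --> \oo] --> J w by exact: continuous_cvg.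
  apply/ler_addgt0Pr => e e0.
  apply: (cvgr_to_le Jyw).
  have := near_infty_natSinv_lt (PosNum e0); apply: filterS => n /= ne.
  by apply/ltW/(lt_le_trans (Jy n)); rewrite lerD2l ltW.
exists w; apply/val_inj/funext => h; rewrite -[LHS]/(ipL L w h).
suff : 2 * (ipL L w h - phi h) = 0 by lra.
apply: (@quadratic_ge0_lin0 _ (ipL L h h)) (ipL_ge0 _ pL) _ => t.
have phiE : phi (w + t *: h) = phi w + t * phi h by rewrite linearD linearZ.
have := le_trans Jw (Jm (w + t *: h)).
rewrite /J phiE !ipLE (sym h w); lra.
Qed.

Lemma invLK L phi : preconditioner L -> L (invL L phi) = phi.
Proof.
move=> pL; have Lsurj : set_surj setT setT L.
  by move=> psi _; have [w Lw] := lax_milgram psi pL; exists w.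
by apply: (surjpK _ Lsurj); rewrite inE.
Qed.

Lemma normLVE L phi : preconditioner L -> normLV L phi = normL L (invL L phi).
Proof. by move=> pL; rewrite /normL /ipL invLK. Qed.

Lemma ipL_invL L phi v : preconditioner L -> ipL L (invL L phi) v = phi v.
Proof. by move=> pL; rewrite /ipL invLK. Qed.

(** Any preimage of [phi] may be used in place of the chosen one; this makes the
    dual norm computable on combinations without the linearity of [invL L]. *)
Lemma normLV_sqr L w phi : preconditioner L -> L w = phi ->
  normLV L phi ^+ 2 = ipL L w w.
Proof.
move=> pL Lw; have [_ sym _ _] := pL.
rewrite normLVE// normL_sqr// ipL_invL// -Lw -[LHS]/(ipL L _ _).
by rewrite sym ipL_invL.
Qed.

Lemma normLVN_sqr L phi : preconditioner L ->
  normLV L (- phi) ^+ 2 = normLV L phi ^+ 2.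
Proof.
move=> pL; have Lp := invLK phi pL.
rewrite (normLV_sqr pL Lp) (@normLV_sqr L (- invL L phi))//.
  by rewrite !ipLE opprK.
by rewrite linearN Lp.
Qed.

Lemma normLV_subL_sqr L phi d (a : R) : preconditioner L ->
  normLV L (phi - a *: L d) ^+ 2 =
  normLV L phi ^+ 2 - 2 * a * phi d + a ^+ 2 * normL L d ^+ 2.
Proof.
move=> pL; have [_ sym _ _] := pL; have Lp := invLK phi pL.
rewrite (normLV_sqr pL Lp) (@normLV_sqr L (invL L phi - a *: d))//; last first.
  by rewrite linearB linearZ/= Lp.
rewrite normL_sqr// !ipLE (sym d (invL L phi)) (ipL_invL _ d pL); ring.
Qed.

Lemma dual_subL_self L phi d (a : R) : preconditioner L ->
  (phi - a *: L d) d = phi d - a * normL L d ^+ 2.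
Proof. by move=> pL; rewrite normL_sqr. Qed.

(** * First-order inequalities from gradient bounds *)

(** Subtracting a multiple of the squared norm shifts the gradient by a multiple
    of [L]: this is what links the gradients of [G] and of [Gt]. *)
Lemma frechet_sub_quadratic L G (a : R) u : preconditioner L ->
  differentiable G u ->
  differentiable (fun v => G v - a * normL L v ^+ 2) u /\
  frechet (fun v => G v - a * normL L v ^+ 2) u = frechet G u - (2 * a) *: L u.
Proof.
move=> pL dG; have dq := is_diff_ipL u pL.
have -> : (fun v => G v - a * normL L v ^+ 2) =
    G - a *: (fun v => ipL L v v) :> (H -> R).
  by apply/funext => v /=; rewrite normL_sqr.
have dG' : is_diff u G (frechet G u).
  by apply: DiffDef => //; rewrite frechetE.
have [dGt dGtE] : is_diff u (G - a *: (fun v => ipL L v v) : H -> R)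
    (dual_fun (frechet G u) - a *: dual_fun (2 *: L u) : H -> R).
  by apply: is_diffB; exact: is_diffZ.
split=> //; apply/val_inj/funext => v.
transitivity ('d (G - a *: (fun v => ipL L v v) : H -> R) u v).
  by rewrite -(frechetE dGt).
rewrite dGtE.
rewrite -[RHS]/(frechet G u v - 2 * a * L u v).
rewrite -[LHS]/(frechet G u v - a * (2 * L u v)).
by rewrite mulrA [a * 2]mulrC.
Qed.

(** The mean value theorem applied to
    [t |-> f (u + t *: h) - c / 2 * t ^+ 2] on [[0, 1]]. The parabola encodes a
    derivative growing at rate [c] along the segment: [c = 0] gives the tangent
    inequality of convexity and [c = K * normL L h ^+ 2] the descent
    inequality. *)
Lemma mean_value_along (f : H -> R) (f' : H -> dual H) (c : R) u h :
  (forall v, is_diff v f (f' v)) ->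
  exists2 s, 0 < s < 1 &
    f (u + h) - f u = f' (u + s *: h) h + c * (2^-1 - s).
Proof.
move=> df.
pose k t := f (u + t *: h) - c / 2 * t ^+ 2.
pose dk t := f' (u + t *: h) h - c * t.
have kE (t : R) : is_derive t 1 k (dk t).
  have dl : is_diff t (fun s : R => u + s *: h) ( *:%R^~ h).
    have -> : ( *:%R^~ h : R -> H) = 0 + ( *:%R^~ h).
      by apply/funext => s; rewrite fctE add0r.
    exact: is_diffD.
  have dfl : is_derive t 1 (fun s : R => f (u + s *: h))
      (f' (u + t *: h) h).
    have [dft dfE] := df (u + t *: h).
    have dll : differentiable (fun s : R => u + s *: h) t by case: dl.
    have dc : differentiable (f \o (fun s : R => u + s *: h)) t.
      exact: differentiable_comp.
    apply: DeriveDef; first exact/derivable1_diffP.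
    rewrite deriveE// diff_comp//.
    by rewrite (@diff_val _ _ _ _ _ _ _ dl)/= scale1r dfE.
  have dsq : is_derive t 1 (fun s : R => c / 2 * s ^+ 2) (c * t).
    apply: is_derive_eq; rewrite /GRing.scale/=.
    by field.
  exact: is_deriveB.
have [|s] := @MVT _ k dk 0 1 ltr01 (fun x _ => kE x).
  apply: continuous_subspaceT => x; apply: differentiable_continuous.
  by apply/derivable1_diffP; case: (kE x).
rewrite in_itv/= => s01; rewrite /k /dk scale1r scale0r addr0 => E.
by exists s => //; move: E; lra.
Qed.

Lemma dual_incr_scale (g : H -> dual H) u h (s : R) :
  (g (u + s *: h) - g u) (u + s *: h - u) =
  s * (g (u + s *: h) h - g u h).
Proof.
by rewrite [X in _ X = _](_ : _ = s *: h) ?linearZ// addrAC subrr add0r.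
Qed.

Lemma convex_set_segment (A : set H) u v (s : R) : convex_set A ->
  A u -> A v -> 0 < s < 1 -> A (u + s *: (v - u)).
Proof.
move=> cA Au Av /andP[s0 s1].
have := cA v u (Itv01 (ltW s0) (ltW s1)); rewrite !inE => /(_ Av Au).
rewrite -[conv _ _ _]/(s *: v + (1 - s) *: u); congr (A _).
rewrite scalerBr scalerBl scale1r addrC -!addrA; congr (_ + _).
by rewrite addrC.
Qed.

Lemma monotone_tangent_le (F : H -> R) (g : H -> dual H) u v :
  (forall x, is_diff x F (g x)) ->
  (forall x y, 0 <= (g x - g y) (x - y)) ->
  F u + g u (v - u) <= F v.
Proof.
move=> dF mF; have [s /andP[s0 s1]] := mean_value_along 0 u (v - u) dF.
rewrite mul0r addr0 [u + _]addrC subrK => E.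
have := mF (u + s *: (v - u)) u; rewrite dual_incr_scale pmulr_rge0//.
rewrite -{}E; move: (g u (v - u)) => a; lra.
Qed.

(** Smoothness bounds the increase of the slope along the segment at time [s] by
    [s * K * normL L (v - u) ^+ 2], which is the growth rate that the mean value
    lemma cancels. *)
Lemma descent L (F : H -> R) (g : H -> dual H) (A : set H) (K : R) u v :
  preconditioner L ->
  (forall x, is_diff x F (g x)) -> convex_set A ->
  (forall x y, A x -> A y ->
    (g x - g y) (x - y) <= K * normL L (x - y) ^+ 2) ->
  A u -> A v ->
  F v <= F u + g u (v - u) + K / 2 * normL L (v - u) ^+ 2.
Proof.
move=> pL dF cA KA Au Av.
have [s s01] := mean_value_along (K * normL L (v - u) ^+ 2) u (v - u) dF.
rewrite [u + _]addrC subrK => E; have /andP[s0 s1] := s01.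
have := KA _ _ (convex_set_segment cA Au Av s01) Au.
rewrite dual_incr_scale [X in normL L X](_ : _ = s *: (v - u)); last first.
  by rewrite addrAC subrr add0r.
rewrite normL_sqr// ipLZl ipLZr.
rewrite [leRHS](_ : _ = s * (s * (K * ipL L (v - u) (v - u)))); last by ring.
rewrite ler_pM2l//; move: E; rewrite normL_sqr//.
move: (g _ (v - u)) (g u (v - u)) => a b; lra.
Qed.

(** * Local cocoercivity *)

(** The function [F - g u], which is minimal at [u], decreases by at least
    [(2 * K)^-1 * normL L p ^+ 2] in the step from [v] to [v - K^-1 *: p], where
    [p] is its [L]-gradient at [v]. The descent inequality is only
    available on [A], so the step must not leave [A]. A first step, of length
    [normL L (v - u)], remains in [A] by assumption; comparing its gain with the
    descent inequality between [u] and [v] gives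
    [normL L p <= K * normL L (v - u)]. Hence the step [K^-1 *: p] is no longer
    than [v - u] and remains in [A] too. *)
Lemma gradient_step_gain L (F : H -> R) (g : H -> dual H) (A : set H) (K : R)
    u v :
  preconditioner L -> (forall x, is_diff x F (g x)) ->
  (forall x y, 0 <= (g x - g y) (x - y)) ->
  0 < K -> convex_set A ->
  (forall x y, A x -> A y ->
    (g x - g y) (x - y) <= K * normL L (x - y) ^+ 2) ->
  (forall w, normL L (w - v) <= normL L (v - u) -> A w) ->
  (2 * K)^-1 * normLV L (g v - g u) ^+ 2 <=
  F v - F u - g u (v - u).
Proof.
move=> pL dF mF K0 cA KA Aball.
have Au : A u by apply: Aball; rewrite normL_distC.
have [->|uv] := eqVneq v u.
  by rewrite !subrr linear0 /normLV /= sqrtr0 expr0n mulr0 subr0.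
have L0 : normL L 0 = 0 by rewrite /normL /ipL linear0 sqrtr0.
have Av : A v by apply: Aball; rewrite subrr L0 sqrtr_ge0.
rewrite normLVE//; set p := invL L _; set D := normL L (v - u).
set P := normL L p.
have D0 : 0 < D.
  have [_ _ _ [C1 C10 C1L]] := pL.
  rewrite sqrtr_gt0; apply: lt_le_trans (C1L _).
  by rewrite mulr_gt0// exprn_gt0// normr_gt0 subr_eq0.
have P0 : 0 <= P by exact: sqrtr_ge0.
(* tangent inequality at u and descent from v, both evaluated at v - t *: p *)
have step t : 0 <= t -> t * P <= D ->
    t * P ^+ 2 <= F v - F u - g u (v - u) + K / 2 * (t ^+ 2 * P ^+ 2).
  move=> t0 tP; pose w := v - t *: p.
  have wv : w - v = - (t *: p) by rewrite /w addrC addKr.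
  have ntp : normL L (- (t *: p)) = t * P.
    apply/eqP; rewrite -(@eqrXn2 _ 2) ?sqrtr_ge0 ?mulr_ge0//.
    by rewrite exprMn !normL_sqr// !ipLE; apply/eqP; ring.
  have Aw : A w by apply: Aball; rewrite wv ntp.
  have lo := monotone_tangent_le u w dF mF.
  have up := descent pL dF cA KA Av Aw.
  have pp : g v p - g u p = P ^+ 2.
    by rewrite normL_sqr// ipL_invL.
  move: up; rewrite wv ntp exprMn linearN linearZ/= => up.
  have wu : w - u = (v - u) - t *: p by rewrite /w addrAC.
  move: lo; rewrite wu linearB linearZ/= => lo.
  move: up lo; rewrite -{}pp.
  move: (g v p) (g u p) (g u (v - u)) => a b c.
  rewrite -[t *: a]/(t * a) -[t *: b]/(t * b); lra.
have desc := descent pL dF cA KA Au Av.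
have PKD : P <= K * D.
  have [->|Pn0] := eqVneq P 0; first by rewrite mulr_ge0// ltW.
  have Pgt : 0 < P by rewrite lt_def Pn0.
  have := step (D / P); rewrite divfK// => /(_ (divr_ge0 (ltW D0) P0) (lexx _)).
  rewrite -exprMn divfK// [X in X <= _](_ : _ = D * P); last by field.
  rewrite -(ler_pM2l D0 P); move: desc; rewrite -/D.
  move: (g u (v - u)) => a; lra.
have KP : K^-1 * P <= D by rewrite ler_pdivrMl.
have Ki0 : 0 <= K^-1 by rewrite invr_ge0 ltW.
have := step K^-1 Ki0 KP.
have -> : K / 2 * (K^-1 ^+ 2 * P ^+ 2) = (2 * K)^-1 * P ^+ 2 by field; lra.
have -> : K^-1 * P ^+ 2 = (2 * K)^-1 * P ^+ 2 + (2 * K)^-1 * P ^+ 2.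
  by field; lra.
move: (g u (v - u)) => a; lra.
Qed.

(** The region that the gradient steps between points of a bounded set can
    reach is bounded, the two norms being equivalent. *)
Lemma gradient_step_bounded L (a : R) : preconditioner L -> 0 <= a ->
  exists r, forall u v, `|u| <= a -> `|v| <= a -> forall w,
    normL L (w - v) <= normL L (v - u) -> `|w| <= r.
Proof.
move=> pL a0; have [_ _ [C2 C20 LC2] [C1 C10 LC1]] := pL.
exists (a + Num.sqrt (C2 / C1) * (2 * a)) => u v ua va w wv.
have vu : `|v - u| <= 2 * a.
  by apply: le_trans (ler_normB _ _) _; lra.
suff wv' : `|w - v| <= Num.sqrt (C2 / C1) * (2 * a).
  by rewrite -(subrK v w) addrC; apply: le_trans (ler_normD _ _) (lerD va wv').
rewrite -(@ler_pXn2r _ 2) ?nnegrE ?mulr_ge0 ?sqrtr_ge0//.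
have C21 : 0 <= C2 / C1 by rewrite divr_ge0 ?ltW.
rewrite exprMn (sqr_sqrtr C21) [leRHS](_ : _ = C1^-1 * (C2 * (2 * a) ^+ 2)).
  rewrite ler_pdivlMl//; apply: le_trans (LC1 _) _; rewrite -normL_sqr//.
  apply: (@le_trans _ _ (normL L (v - u) ^+ 2)).
    by rewrite ler_pXn2r ?nnegrE ?sqrtr_ge0.
  rewrite normL_sqr//; apply: le_trans (LC2 _ _) _.
  by rewrite -mulrA -expr2 ler_pM2l// ler_pXn2r ?nnegrE ?mulr_ge0.
by field; lra.
Qed.

Lemma convex_set_norm_ball (r : R) : convex_set [set v : H | `|v| <= r].
Proof.
move=> x y k; rewrite !inE => xr yr.
rewrite -[conv _ _ _]/(k%:num *: x + (1 - k%:num) *: y) /=.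
apply: le_trans (ler_normD _ _) _; rewrite !normrZ.
have k0 : 0 <= k%:num by [].
have k1 : k%:num <= 1 by [].
rewrite !ger0_norm ?subr_ge0//=.
apply: le_trans (lerD (ler_wpM2l k0 xr) (ler_wpM2l _ yr)) _.
  by rewrite subr_ge0.
by lra.
Qed.

Lemma bounded_norm_ball (r : R) : bounded_set [set v : H | `|v| <= r].
Proof.
exists r; split=> [|a ra v vr]; first exact: num_real.
exact: le_trans vr (ltW ra).
Qed.

(** Adding the estimates for the pairs [(u, v)] and [(v, u)] eliminates the
    values of [F]. Smoothness is used on a ball around [B] containing all the
    gradient steps. *)
Lemma monotone_cocoercive L (F : H -> R) (B : set H) : preconditioner L ->
  (forall x, differentiable F x) ->
  (forall x y, 0 <= (frechet F x - frechet F y) (x - y)) ->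
  locally_Lipschitz_smooth L F -> bounded_set B ->
  exists2 K, 0 < K & forall u v, B u -> B v ->
    K^-1 * normLV L (frechet F v - frechet F u) ^+ 2 <=
    (frechet F v - frechet F u) (v - u).
Proof.
move=> pL dF mF sF [b [_ bB]].
have gF x : is_diff x F (frechet F x).
  by apply: DiffDef => //; rewrite frechetE.
pose a := `|b| + 1.
have Ba v : B v -> `|v| <= a.
  by apply: bB; rewrite (le_lt_trans (ler_norm _))// ltrDl.
have a0 : 0 <= a by rewrite addr_ge0.
have [r Hr] := gradient_step_bounded pL a0.
have [K K0 HK] := sF _ (bounded_norm_ball r) (convex_set_norm_ball (r := r)).
exists K => // u v Bu Bv.
move: (frechet F) gF mF HK => g gF mF HK.
have half x y : B x -> B y -> (2 * K)^-1 *
    normLV L (g y - g x) ^+ 2 <=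
    F y - F x - g x (y - x).
  move=> Bx By.
  apply: (gradient_step_gain pL gF mF K0 (convex_set_norm_ball (r := r)) HK).
  by move=> w; exact: (Hr x y (Ba _ Bx) (Ba _ By)).
have := lerD (half _ _ Bu Bv) (half _ _ Bv Bu).
rewrite -[g u - g v]opprB normLVN_sqr// -mulrDl.
rewrite [X in X * _ <= _](_ : _ = K^-1); last by field; lra.
rewrite dualBE -(opprB v u) linearN/=.
move: (g u (v - u)) (g v (v - u)) => c d; lra.
Qed.

(** Expanding the shifted terms and multiplying by [mu + K], the conclusion is
    the hypothesis with the terms in [mu] collected. *)
Lemma cocoercive_unshift L (mu K : R) phi d :
  preconditioner L -> 0 < mu -> 0 < K ->
  K^-1 * normLV L (phi - (mu / 2) *: L d) ^+ 2 <= (phi - (mu / 2) *: L d) d ->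
  (mu ^+ 2 + 2 * mu * K) / (4 * K + 4 * mu) * normL L d ^+ 2 +
  (mu + K)^-1 * normLV L phi ^+ 2 <= phi d.
Proof.
move=> pL mu0 K0; rewrite normLV_subL_sqr// dual_subL_self// ler_pdivrMl// => h.
have muK0 : 0 < mu + K by rewrite addr_gt0.
rewrite -(ler_pM2l muK0).
rewrite [leLHS](_ : _ = (mu ^+ 2 / 4 + mu / 2 * K) * normL L d ^+ 2 +
  normLV L phi ^+ 2); last by field; lra.
by move: h; move: (normL L d) (normLV L phi) (phi d) => n p c; lra.
Qed.

End energy_form.

(** * Cocoercivity with the strong convexity retained *)

Theorem lemma2p7 (R : realType) (H : hilbertType R) (L : {linear H -> dual H})
    (mu : R) (G : H -> R) :
  separable H -> preconditioner L -> 0 < mu ->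
  continuously_differentiable G ->
  strongly_convex L mu G -> locally_Lipschitz_smooth L G ->
  let Gt (v : H) : R := G v - mu / 4 * normL L v ^+ 2 in
  forall B : set H, bounded_set B -> convex_set B ->
  let cocoercive (K : R) := forall u v, B u -> B v ->
    K^-1 * normLV L (frechet Gt v - frechet Gt u) ^+ 2 <=
    (frechet Gt v - frechet Gt u) (v - u) in
  (exists2 LB, 0 < LB & cocoercive LB) /\
  (forall LB, 0 < LB -> cocoercive LB ->
   let CB1 := (mu ^+ 2 + 2 * mu * LB) / (4 * LB + 4 * mu) in
   let CB2 := (mu + LB)^-1 in
   [/\ 0 < CB1, 0 < CB2 &
     forall u v, B u -> B v ->
       CB1 * normL L (v - u) ^+ 2 + CB2 * normLV L (frechet G v - frechet G u) ^+ 2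
       <= (frechet G v - frechet G u) (v - u)]).
Proof.
move=> _ pL mu0 [dG _] scG sG Gt B bB cB cocoercive.
have Gt_incr u v : frechet Gt v - frechet Gt u =
    (frechet G v - frechet G u) - (mu / 2) *: L (v - u).
  have GtE x : frechet Gt x = frechet G x - (mu / 2) *: L x.
    rewrite (frechet_sub_quadratic (mu / 4) pL (dG x)).2.
    by rewrite (_ : 2 * (mu / 4) = mu / 2)//; field.
  by rewrite !GtE [L (v - u)]linearB scalerBr !opprD !opprK addrACA.
have dGt x : differentiable Gt x.
  exact: (frechet_sub_quadratic (mu / 4) pL (dG x)).1.
have N0 (x : H) : 0 <= normL L x ^+ 2 by rewrite exprn_ge0// sqrtr_ge0.
have mGt x y : 0 <= (frechet Gt x - frechet Gt y) (x - y).
  rewrite (Gt_incr y x) dual_subL_self//.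
  rewrite subr_ge0; apply: le_trans (scG x y).
  by rewrite ler_wpM2r//; lra.
have sGt : locally_Lipschitz_smooth L Gt.
  move=> A bA cA; have [K K0 KA] := sG A bA cA; exists K; first exact: K0.
  move=> x y Ax Ay.
  rewrite (Gt_incr y x) dual_subL_self//.
  apply: le_trans (KA _ _ Ax Ay).
  by rewrite gerBl mulr_ge0// divr_ge0// ltW.
split; first exact: (monotone_cocoercive pL dGt mGt sGt bB).
move=> K K0 cK CB1 CB2; split.
- by rewrite divr_gt0 ?addr_gt0 ?mulr_gt0 ?exprn_gt0.
- by rewrite invr_gt0 addr_gt0.
move=> u v Bu Bv; apply: (cocoercive_unshift pL mu0 K0).
by rewrite -(Gt_incr u v); exact: cK.
Qed.
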